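(* Let $\tau$ be a cardinal and let $S=\{X_\alpha,p^\beta_\alpha,\alpha<\beta<\tau\}$ be an almost continuous inverse system with nearly open bonding maps such that $X$ is the almost limit of $S$, $X=\mathrm{a}\text{-}\varprojlim S$. Then: (1) $X$ is regularly embedded in $\prod_{\alpha<\tau}X_\alpha$; (2) if, additionally, each $X_\alpha$ is regularly embedded in a space $Y_\alpha$, then $X$ is regularly embedded in $\prod_{\alpha<\tau}Y_\alpha$.
   Context: All topological spaces are Tychonoff and all maps are continuous. The index set of $S$ is the set of ordinals less than $\tau$, with bonding maps $p^\beta_\alpha:X_\beta\to X_\alpha$. $\mathcal{T}_X$ denotes the topology of $X$. Nearly open: a map $f:X\to Y$ is nearly open if $f(U)\subset\mathrm{Int}\,\overline{f(U)}$ for every open $U\subset X$. Almost limit: $X=\mathrm{a}\text{-}\varprojlim S$ means that $X$ is embedded in $\varprojlim S$ and $p_\alpha(X)=X_\alpha$ for each $\alpha$, where $p_\alpha:\varprojlim S\to X_\alpha$ is the $\alpha$-th limit projection. Almost continuous: $S$ is almost continuous if for every limit ordinal $\gamma<\tau$ the space $X_\gamma$ is (via the maps $p^\gamma_\alpha$, $\alpha<\gamma$) the almost limit of the inverse system $S_\gamma=\{X_\alpha,p^\beta_\alpha,\alpha<\beta<\gamma\}$. Regularly embedded: a subspace $X\subset Y$ is regularly embedded in $Y$ if there is a function $\mathrm{e}:\mathcal{T}_X\to\mathcal{T}_Y$ such that for all $U,V\in\mathcal{T}_X$: (i) $\mathrm{e}(U)\cap\mathrm{e}(V)=\varnothing$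 whenever $U\cap V=\varnothing$; (ii) $\mathrm{e}(U)\cap X=U$. $X$ is regarded as a subspace of $\prod_{\alpha<\tau}X_\alpha$ via the embedding $x\mapsto(p_\alpha(x))_{\alpha<\tau}$ and, in (2), as a subspace of $\prod_{\alpha<\tau}Y_\alpha$ via $X\subset\prod_{\alpha<\tau}X_\alpha\subset\prod_{\alpha<\tau}Y_\alpha$. *)

(* Defs.v *)
From HB Require Import structures.
From mathcomp Require Import all_boot all_order all_algebra.
From mathcomp Require Import all_classical all_reals all_analysis.
From mathcomp Require Import wochoice.

Set Implicit Arguments.
Unset Strict Implicit.
Unset Printing Implicit Defensive.

Import Order.TTheory.
Local Open Scope order_scope.
Local Open Scope classical_set_scope.

Definition tychonoff_space (T : topologicalType) : Prop :=
  hausdorff_space T /\ completely_regular_space T.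

Definition nearly_open (T U : topologicalType) (f : T -> U) : Prop :=
  forall A : set T, open A -> f @` A `<=` (closure (f @` A))°.

Definition embedding (T U : topologicalType) (f : T -> U) : Prop :=
  [/\ continuous f, injective f &
      forall A : set T, open A ->
        exists2 B : set U, open B & f @` A = B `&` range f].

(* The subspace is given by its inclusion [f]: [T] is identified with [range f]
   and [A] with [f @` A]. The values of [e] off the open sets are irrelevant. *)
Definition regularly_embedded (T U : topologicalType) (f : T -> U) : Prop :=
  embedding f /\
  exists e : set T -> set U,
    [/\ forall A, open A -> open (e A),
        forall A B, open A -> open B -> A `&` B = set0 -> e A `&` e B = set0 &
        forall A, open A -> e A `&` range f = f @` A].

(* A cardinal is an initial ordinal: a well-order, no proper initial segment of
   which is as large as the whole. The order [I] plays the role of the set of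
   ordinals less than it. *)
Definition cardinal_order d (I : orderType d) : Prop :=
  well_order (<=%O : rel I) /\
  forall a : I, ~ ([set: I] #<= [set b : I | b < a])%card.

Definition limit_index d (I : orderType d) (c : I) : Prop :=
  (exists a, a < c) /\ (forall a, a < c -> exists2 b, a < b & b < c).

Record inverse_system (I : Type) (lt : rel I) := InverseSystem {
  sys_space :> I -> topologicalType;
  bond : forall a b : I, lt a b -> sys_space b -> sys_space a;
  bond_continuous : forall a b (ab : lt a b), continuous (bond ab);
  bond_comp : forall a b c (ab : lt a b) (bc : lt b c) (ac : lt a c) x,
    bond ab (bond bc x) = bond ac x }.

Arguments bond {I lt} S {a b} ab : rename.

Definition inverse_limit (I : Type) (lt : rel I) (S : inverse_system lt) :
    set (prod_topology (sys_space S)) :=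
  [set x | forall a b (ab : lt a b), bond S ab (x b) = x a].

Arguments inverse_limit {I lt} S.

Definition diagonal_map (I T : Type) (K : I -> Type) (p : forall a, T -> K a) :
    T -> prod_topology K :=
  fun x a => p a x.

(* [X], embedded in the limit by [diagonal_map p], is the almost limit of [S];
   [p a] is then the restriction to [X] of the [a]-th limit projection. *)
Definition almost_limit (I : Type) (lt : rel I) (S : inverse_system lt)
    (X : topologicalType) (p : forall a, X -> S a) : Prop :=
  [/\ embedding (diagonal_map p : X -> prod_topology (sys_space S)),
      range (diagonal_map p) `<=` inverse_limit S &
      forall a, range (p a) = [set: S a]].

Definition below (I : Type) (lt : rel I) (c : I) : Type := {a : I | lt a c}.

Definition subsystem_below (I : Type) (lt : rel I) (S : inverse_system lt)
    (c : I) : inverse_system (fun a b : below lt c => lt (sval a) (sval b)) :=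
  @InverseSystem (below lt c) (fun a b => lt (sval a) (sval b))
    (fun a => S (sval a))
    (fun a b ab => bond S ab)
    (fun a b ab => @bond_continuous _ _ S _ _ ab)
    (fun a b c ab bc ac => @bond_comp _ _ S _ _ _ ab bc ac).

Definition almost_continuous d (I : orderType d)
    (S : inverse_system (<%O : rel I)) : Prop :=
  forall c : I, limit_index c ->
    almost_limit (S := subsystem_below S c)
      (fun a : below (<%O : rel I) c => bond S (proj2_sig a)).

(* Main.v *)
Require Import Defs.
From mathcomp Require Import all_boot all_order all_algebra.
From mathcomp Require Import all_classical all_reals all_analysis.
From mathcomp Require Import wochoice.

(** Part (1) is the case [Y = S], [i = id] of part (2), so only products of
    spaces [Y a] in which the [S a] are regularly embedded, with operators
    [e a], need attention.

    The extension operator sends an open [U] to the union of certain open boxes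
    of the product. A box is given by finitely many indices [a] and open sets
    [V] of [S a]; it consists of the [y] with [y a] in [e a V], and its trace on
    [X] is the intersection of the sets [p a @^-1` V]. Arbitrary boxes will not
    do: two nonempty boxes that constrain different coordinates always meet,
    while their traces may be disjoint. The boxes used are those built by adding one
    constraint [(a, V)] at a time to a box of trace [W], where [p a @^-1` V] is
    included in [W] and is dense in [W] as seen from every index [c < a]: each
    [p c @^-1` H] with [H] open that meets [W] meets [p a @^-1` V]. These are
    the towers.

    Towers separate ([tower_meet]). If the boxes of two towers meet and their
    last indices differ, the one with the larger last index may be stripped of
    its last constraint: by induction the remaining traces meet, and density
    over the smaller last index gives the conclusion back. If the last indices
    coincide, [e a V] and [e a V'] meet, hence so do [V] and [V'].

    Towers abound ([tower_level], [tower_base]). By well-founded induction on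
    [b], the traces of towers that come from open sets of [S b] refine every
    neighbourhood of [p b x]. At a limit [b], almost continuity gives a basic
    neighbourhood that comes from some [a < b]. At the least index a single
    constraint makes a tower. At the successor [b] of [a], an open [V] has an
    image that is dense in an open set [O] around [p a x], because the bonding
    map is nearly open; cutting [V] down to a tower at [a] inside [O] makes it
    dense in that tower as seen from [a], hence from all indices below [b]. *)

Set Implicit Arguments.
Unset Strict Implicit.
Unset Printing Implicit Defensive.

Import Order.TTheory.
Local Open Scope order_scope.
Local Open Scope classical_set_scope.

(** * Base of the almost limit *)

Lemma cvg_prod_topology (J : Type) (K : J -> topologicalType)
    (F : set_system (prod_topology K)) (t : prod_topology K) :
  Filter F ->
  (forall j (V : set (K j)), open V -> V (t j) -> F [set y | V (y j)]) ->
  F --> t.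
Proof.
move=> FF FV; apply/cvg_sup => j A [B [[C oC <-] Ct] sBA].
by apply: filterS sBA _; apply: FV.
Qed.

Section Base.
Context (J : Type) (lt : rel J) (S : inverse_system lt) (Z : topologicalType).
Variable q : forall a : J, Z -> S a.
Hypothesis q_emb :
  embedding (diagonal_map q : Z -> prod_topology (sys_space S)).
Hypothesis q_lim : range (diagonal_map q) `<=` inverse_limit S.

Lemma bond_proj a b (ab : lt a b) z : bond S ab (q b z) = q a z.
Proof. exact: (q_lim (imageT (diagonal_map q) z)). Qed.

Lemma cylinder_raise a b (ab : lt a b) (V : set (S a)) : open V ->
  exists2 V' : set (S b), open V' & q a @^-1` V = q b @^-1` V'.
Proof.
move=> oV; exists (bond S ab @^-1` V).
  by apply: open_comp => // x _; exact: bond_continuous.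
by apply/seteqP; split=> z; rewrite /preimage /= bond_proj.
Qed.

(** Finite intersections of cylinders are single cylinders because the indices
    are linearly ordered. The order is a bare relation so that the lemma covers
    the subsystem below a limit index as well as the whole system. *)
Lemma cylinder_base (lt_total : forall a b, [\/ a = b, lt a b | lt b a])
    (a0 : J) (U : set Z) (z : Z) : open U -> U z ->
  exists a, exists2 V : set (S a), open V & V (q a z) /\ q a @^-1` V `<=` U.
Proof.
move=> oU Uz; have [_ q_inj q_open] := q_emb.
pose D := [set V : {a : J & set (S a)} |
  open (projT2 V) /\ projT2 V (q (projT1 V) z)].
pose F := filter_from D (fun V => q (projT1 V) @^-1` projT2 V).
(* [F] is generated by the cylinders around [z]; its image converges to the
   image of [z] in the product, and [diagonal_map q] is an embedding, so the
   open set [U] belongs to [F]. *)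
have FF : Filter F.
  apply: filter_from_filter.
    by exists (existT _ a0 setT); split=> //; exact: openT.
  have DI a (V W : set (S a)) : open V -> V (q a z) -> open W -> W (q a z) ->
      D (existT _ a (V `&` W)).
    by move=> oV Vz oW Wz; split=> //; exact: openI.
  move=> [a V] [b W] [/= oV Vz] [/= oW Wz].
  have [ab|ab|ba] := lt_total a b.
  - by subst b; exists (existT _ a (V `&` W)) => //; exact: DI.
  - have [V' oV' VV'] := cylinder_raise ab oV.
    have V'z : V' (q b z) by have : (q b @^-1` V') z by rewrite -VV'.
    by exists (existT _ b (V' `&` W)); [exact: DI | rewrite VV'].
  - have [W' oW' WW'] := cylinder_raise ba oW.
    have W'z : W' (q a z) by have : (q a @^-1` W') z by rewrite -WW'.
    by exists (existT _ a (V `&` W')); [exact: DI | rewrite WW'].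
have Fz :
    diagonal_map q @ F --> (diagonal_map q z : prod_topology (sys_space S)).
  by apply: cvg_prod_topology => a V oV Vz; exists (existT _ a V).
have [B oB UB] := q_open U oU.
have [Bz _] : (B `&` range (diagonal_map q)) (diagonal_map q z).
  by rewrite -UB; exists z.
have [[a V] [oV Vz] sVB] := Fz B (open_nbhs_nbhs (conj oB Bz)).
exists a, V => //; split=> // y Vy.
have : (diagonal_map q @` U) (diagonal_map q y).
  by rewrite UB; split; [exact: sVB | exact: imageT].
by case=> y' Uy' /q_inj <-.
Qed.

End Base.

(** * Towers *)

Section Tower.
Context d (I : orderType d) (S : inverse_system (<%O : rel I)).
Context (X : topologicalType) (p : forall a : I, X -> S a).
Context (Y : I -> topologicalType) (e : forall a, set (S a) -> set (Y a)).

(** [tower W B] relates the trace [W] of a tower to its box [B]. Density is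
    asked for below the index being added, because [tower_meet] compares a tower
    with one whose last index is smaller. *)
Inductive tower : set X -> set (prod_topology Y) -> Prop :=
| tower_top : tower setT setT
| tower_step a (V : set (S a)) W B :
    tower W B -> open V -> p a @^-1` V `<=` W ->
    (forall c (H : set (S c)), c < a -> open H ->
       W `&` p c @^-1` H !=set0 -> p a @^-1` V `&` p c @^-1` H !=set0) ->
    tower (p a @^-1` V) (B `&` [set y | e V (y a)]).

(** The heart of the separation property: at each step the tower with the
    larger last index is the one that is shortened, since the trace of the other
    is then a cylinder below that index, to which density applies. *)
Lemma tower_meet
    (p_surj : forall a, range (p a) = [set: S a])
    (e_disj : forall a (V V' : set (S a)), open V -> open V' ->
       e V `&` e V' !=set0 -> V `&` V' !=set0)
    W B W' B' :
  tower W B -> tower W' B' -> W !=set0 -> W' !=set0 -> B `&` B' !=set0 ->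
  W `&` W' !=set0.
Proof.
have sub_ne (A C : set X) : A `<=` C -> A !=set0 -> C !=set0.
  by move=> AC [x /AC]; exists x.
move=> tW; elim: tW W' B' => {W B} [|a V W B tW IH oV VW V_dense] W' B'.
  by move=> _ _ W'0 _; rewrite setTI.
elim=> {W' B'} [|a' V' W' B' tW' IH' oV' VW' V'_dense].
  by move=> W0 _ _; rewrite setIT.
move=> V0 V'0 [y [[By Vy] [B'y V'y]]].
case: (ltgtP a a') => [aa'|a'a|aa'].
- rewrite setIC; apply: V'_dense => //; rewrite setIC.
  by apply: IH' => //; [exact: sub_ne V'0 | exists y].
- apply: V_dense => //.
  apply: IH (tower_step tW' oV' VW' V'_dense) _ _ _ => //.
    exact: sub_ne V0.
  by exists y.
- subst a'; have [s [Vs V's]] : V `&` V' !=set0.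
    by apply: e_disj => //; exists (y a).
  have [x _ xs] : range (p a) s by rewrite p_surj.
  by exists x; split; rewrite /= xs.
Qed.

Lemma tower_open (e_open : forall a (V : set (S a)), open V -> open (e V)) W B :
  tower W B -> open B.
Proof.
elim=> {W B} [|a V W B _ IH oV _ _]; first exact: openT.
apply: openI => //.
pose pr := @proj I Y a : prod_topology Y -> Y a.
suff : open (pr @^-1` e V) by [].
by apply: open_comp (e_open _ _ oV) => y _; exact: proj_continuous.
Qed.

Lemma tower_trace (i : forall a, S a -> Y a)
    (e_trace : forall a (V : set (S a)) s, open V -> e V (i a s) <-> V s)
    W B x :
  tower W B -> B (diagonal_map (fun a x => i a (p a x)) x) <-> W x.
Proof.
elim=> {W B} // a V W B _ IH oV VW _; split.
  by case=> _ /(e_trace _ _ _ oV).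
by move=> Vx; split; [exact/IH/VW | exact/(e_trace _ _ _ oV)].
Qed.

Section Exists.
Hypothesis wo : well_order (<=%O : rel I).
Hypothesis acS : almost_continuous S.
Hypothesis noS : forall (a b : I) (ab : (a < b)%O), nearly_open (bond S ab).
Hypothesis limX : almost_limit p.

Lemma lt_well_founded : well_founded (<%O : rel I).
Proof.
move=> a; apply: contrapT => nAa.
have [|b [[/asboolP nAb b_min] _]] := @wo (fun b => `[< ~ Acc <%O b >]).
  by exists a; apply/asboolP.
apply: nAb; constructor=> c cb; apply: contrapT => nAc.
by have := b_min c; rewrite leNgt cb => /(_ (introT (asboolP _) nAc)).
Qed.

(** The induction is on the level [b]; the set [G] records that the trace of
    the tower still comes from an open set of [S b], which is what density at
    the next level is checked against. *)
Lemma tower_level b x (V : set (S b)) : open V -> V (p b x) ->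
  exists G, exists2 B, tower (p b @^-1` G) B &
    [/\ open G, G `<=` V & G (p b x)].
Proof.
have [p_emb p_lim p_surj] := limX.
have bondE a c (ac : a < c) z : bond S ac (p c z) = p a z.
  exact: (bond_proj p_lim).
elim/(well_founded_ind lt_well_founded): b x V => b IH x V oV Vx.
have [lim_b|] := pselect (limit_index b).
  have [b_emb b_lim _] := acS lim_b; have [[a0 a0b] _] := lim_b.
  have lt_total (u v : below (<%O : rel I) b) :
      [\/ u = v, sval u < sval v | sval v < sval u].
    case: (ltgtP (sval u) (sval v)) => uv;
      [exact: Or32 | exact: Or33 | apply: Or31].
    by case: u v uv => [u ub] [v vb] /= uv; subst v; congr exist;
      exact: bool_irrelevance.
  have [[a ab] [/= V' oV' [V'x sV'V]]] :=
    cylinder_base b_emb b_lim lt_total (exist _ a0 a0b) oV Vx.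
  have [|G [B tG [oG GV' Gx]]] := IH a ab x V' oV'.
    by rewrite -(bondE _ _ ab).
  exists (bond S ab @^-1` G), B.
    suff -> : p b @^-1` (bond S ab @^-1` G) = p a @^-1` G by [].
    by apply/seteqP; split=> z; rewrite /preimage /= bondE.
  split=> [|s /GV' /sV'V //|]; last by rewrite /preimage /= bondE.
  by apply: open_comp => // s _; exact: bond_continuous.
move=> not_lim.
have [[a [ab a_max]]|no_pred] := pselect
    (exists a, a < b /\ forall c, c < b -> c <= a); last first.
  (* [b] is the least index *)
  have b_min c : ~ c < b.
    move=> cb; apply: not_lim; split; first by exists c.
    move=> a ab; apply: contrapT => no_mid; apply: no_pred.
    exists a; split=> // c' c'b; rewrite leNgt; apply/negP => ac'.
    by apply: no_mid; exists c'.
  exists V, (setT `&` [set y | e V (y b)]); last by split.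
  by apply: (tower_step tower_top) => // c H /b_min.
(* [b] is the successor of [a] *)
have [|G [B tG [oG GV Gx]]] :=
    IH a ab x (closure (bond S ab @` V))° (@open_interior _ _).
  by apply: noS => //; exists (p b x) => //; exact: bondE.
have oG' : open (bond S ab @^-1` G).
  by apply: open_comp => // s _; exact: bond_continuous.
exists (V `&` bond S ab @^-1` G),
  (B `&` [set y | e (V `&` bond S ab @^-1` G) (y b)]).
  apply: tower_step tG _ _ _; first exact: openI.
    by move=> z [_]; rewrite /preimage /= bondE.
  move=> c H cb oH [z [Gz Hz]].
  (* a cylinder over [c < b] is a cylinder over [a], as [c <= a] *)
  have [H' oH' HH'] : exists2 H', open H' & p c @^-1` H = p a @^-1` H'.
    case: (ltgtP c a) (a_max c cb) => [ca _|//|ca _].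
      exact: (cylinder_raise p_lim ca oH).
    by subst c; exists H.
  have H'z : H' (p a z) by have : (p a @^-1` H') z by rewrite -HH'.
  have [s [[v Vv <-] [Gv H'v]]] : (bond S ab @` V) `&` (G `&` H') !=set0.
    apply: (interior_subset (GV _ Gz)).
    by apply: open_nbhs_nbhs; split; [exact: openI | split].
  have [w _ wv] : range (p b) v by rewrite p_surj.
  exists w; rewrite HH'; subst v; split=> //.
  by rewrite /preimage /= -(bondE _ _ ab).
split; [exact: openI | by move=> s [] | split=> //].
by rewrite /preimage /= bondE.
Qed.

Lemma tower_base (U : set X) x : open U -> U x ->
  exists W, exists2 B, tower W B & W x /\ W `<=` U.
Proof.
move=> oU Ux; have [p_emb p_lim _] := limX.
have [[a0]|noI] := pselect (inhabited I).
  have lt_total (a b : I) : [\/ a = b, a < b | b < a].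
    by case: (ltgtP a b) => ?; [exact: Or32 | exact: Or33 | exact: Or31].
  have [a [V oV [Vx VU]]] := cylinder_base p_emb p_lim lt_total a0 oU Ux.
  have [G [B tG [oG GV Gx]]] := tower_level oV Vx.
  by exists (p a @^-1` G), B => //; split=> // z /GV /VU.
(* without indices [X] has at most one point, and the empty tower will do *)
exists setT, setT; first exact: tower_top.
split=> // z _; suff -> : z = x by [].
have [_ p_inj _] := p_emb; apply: p_inj => //.
by apply: functional_extensionality_dep => a; case: noI.
Qed.

End Exists.
End Tower.

(** * Regular embedding into products *)

Lemma regularly_embedded_prod d (I : orderType d)
    (wo : well_order (<=%O : rel I))
    (S : inverse_system (<%O : rel I))
    (acS : almost_continuous S)
    (noS : forall (a b : I) (ab : (a < b)%O), nearly_open (bond S ab))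
    (X : topologicalType) (p : forall a : I, X -> S a) (limX : almost_limit p)
    (Y : I -> topologicalType) (i : forall a : I, S a -> Y a)
    (regi : forall a : I, regularly_embedded (i a)) :
  regularly_embedded
    (diagonal_map (fun a x => i a (p a x)) : X -> prod_topology Y).
Proof.
set f := diagonal_map _; have [p_emb p_lim p_surj] := limX.
have [p_cts p_inj _] := p_emb.
pose e a := sval (cid (proj2 (regi a))).
have eP a := svalP (cid (proj2 (regi a))).
have i_inj a : injective (i a) by have [[]] := regi a.
have e_open a V : open V -> open (e a V) by have [+ _ _] := eP a; apply.
have e_trace a (V : set (S a)) s : open V -> e a V (i a s) <-> V s.
  move=> oV; have [_ _ /(_ V oV) eV] := eP a; split.
    move=> eVs; have : (e a V `&` range (i a)) (i a s) by split.
    by rewrite eV => -[t Vt /i_inj <-].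
  move=> Vs; have [] // : (e a V `&` range (i a)) (i a s).
  by rewrite eV; exists s.
have e_disj a (V V' : set (S a)) : open V -> open V' ->
    e a V `&` e a V' !=set0 -> V `&` V' !=set0.
  move=> oV oV'; have [_ + _] := eP a => /(_ V V' oV oV') eVV'.
  move=> /set0P eVV'0; apply/set0P/eqP => /eVV' /eqP.
  by rewrite (negbTE eVV'0).
(* [W !=set0] excludes the empty tower, whose box is the whole product, when
   [X] is empty. *)
pose E (U : set X) : set (prod_topology Y) := fun y =>
  exists W, exists B, [/\ tower p e W B, W !=set0, W `<=` U & B y].
have E_open U : open (E U).
  rewrite openE => y [W [B [tW W0 WU By]]].
  have oB : open B by exact: tower_open tW.
  rewrite /interior nbhsE; exists B => // z Bz; by exists W, B.
have E_trace U : open U -> E U `&` range f = f @` U.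
  move=> oU; apply/seteqP.
  split=> [y [[W [B [tW _ WU By]]] [x _ xy]]|_ [x Ux <-]].
    rewrite -xy in By *; exists x => //; apply: WU.
    exact/(tower_trace e_trace _ tW).
  split; last exact: imageT.
  have [W [B tW [Wx WU]]] := tower_base e wo acS noS limX oU Ux.
  by exists W, B; split=> //; [exists x | apply/(tower_trace e_trace _ tW)].
split; last first.
  exists E; split=> // A A' oA oA' AA'; apply/eqP; apply: contrapT.
  move=> /negP/set0P[y [[W [B [tW W0 WA By]]] [W' [B' [tW' W'0 W'A' B'y]]]]].
  have [|x [/WA Ax /W'A' A'x]] := tower_meet p_surj e_disj tW tW' W0 W'0.
    by exists y.
  by have : (A `&` A') x by []; rewrite AA'.
split.
- have pa_cts a : continuous (p a).
    pose pr := @proj I (sys_space S) a : prod_topology (sys_space S) -> S a.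
    move=> x; apply: (@continuous_comp _ _ _ (diagonal_map p) pr).
      exact: p_cts.
    exact: proj_continuous.
  move=> x; apply: cvg_prod_topology => a V oV Vx.
  have [[i_cts _ _] _] := regi a.
  apply: (@continuous_comp _ _ _ (p a) (i a) x).
  - exact: pa_cts.
  - exact: i_cts.
  - exact: open_nbhs_nbhs.
- move=> x y fxy; apply: p_inj; apply: functional_extensionality_dep => a.
  exact: i_inj (f_equal (fun g => g a) fxy).
- by move=> A oA; exists (E A) => //; rewrite E_trace.
Qed.

Lemma regularly_embedded_id (T : topologicalType) :
  regularly_embedded (id : T -> T).
Proof.
split; last by exists id; split=> // A _; rewrite !image_id setIT.
split=> [x||A oA] //; exists A => //.
by rewrite !image_id setIT.
Qed.

Theorem proposition4p3 (d : Order.disp_t) (I : orderType d)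
    (cardI : cardinal_order I)
    (S : inverse_system (<%O : rel I))
    (tychS : forall a : I, tychonoff_space (S a))
    (acS : almost_continuous S)
    (noS : forall (a b : I) (ab : (a < b)%O), nearly_open (bond S ab))
    (X : topologicalType) (tychX : tychonoff_space X)
    (p : forall a : I, X -> S a) (limX : almost_limit p) :
  regularly_embedded (diagonal_map p : X -> prod_topology (sys_space S)) /\
  (forall (Y : I -> topologicalType) (i : forall a : I, S a -> Y a),
    (forall a : I, tychonoff_space (Y a)) ->
    (forall a : I, regularly_embedded (i a)) ->
    regularly_embedded
      (diagonal_map (fun a x => i a (p a x)) : X -> prod_topology Y)).
Proof.
have [wo _] := cardI; split=> [|Y i _ regi].
  apply: (regularly_embedded_prod wo acS noS limX (i := fun a => id)) => a.
  exact: regularly_embedded_id.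
exact: regularly_embedded_prod.
Qed.
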